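(* Let $p,q,r$ be pairwise coprime positive integers, let $\Sigma(p,q,r)$ be the Brieskorn homology sphere, and let $x,y,z,h$ be the generators of $\pi_1(\Sigma(p,q,r))$ in the presentation $$\pi_1(\Sigma(p,q,r))= \langle x,y,z,h\mid h\ \text{central},\ x^ph^a=y^qh^b=z^rh^c=xyz=1\rangle,$$ where $a,b,c$ are integers satisfying $\frac{a}{p}+\frac{b}{q}+\frac{c}{r}=\frac{1}{pqr}$. Let $\rho,\rho':\pi_1(\Sigma(p,q,r))\to \mathrm{SU}(2,1)$ be two irreducible representations. Then $\rho$ and $\rho'$ are conjugate (by an element of $\mathrm{SU}(2,1)$) if and only if both of the following hold: (1) $\rho(x)$ is conjugate to $\rho'(x)$, $\rho(y)$ is conjugate to $\rho'(y)$, and $\rho(h)$ is conjugate to $\rho'(h)$ in $\mathrm{SU}(2,1)$; (2) $t_{\rho(xy)}=t_{\rho'(xy)}$, $\quad t_{\rho(x^{-1}y)}=t_{\rho'(x^{-1}y)}$, $\quad \Im(t_{\rho([x,y])})=\Im(t_{\rho'([x,y])})$.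
   Context: $\mathrm{SU}(2,1)$ is the special unitary group of the indefinite Hermitian product $\langle Z,W\rangle_{2,1}=Z_1\overline{W}_1+Z_2\overline{W}_2-Z_3\overline{W}_3$ on $\mathbf{C}^3$, i.e. the group of $3\times 3$ complex matrices of determinant $1$ preserving this product. A representation is irreducible if it has no invariant subspace of $\mathbf{C}^3$ other than $0$ and $\mathbf{C}^3$. $t_A$ denotes the trace of a matrix $A$, $[A,B]=ABA^{-1}B^{-1}$, and $\Im$ denotes the imaginary part. The Brieskorn homology sphere $\Sigma(p,q,r)$ is the link of singularity $\{(x,y,z)\in\mathbf{C}^3\mid x^p+y^q+z^r=0\}\cap \mathbf{S}^5_\epsilon$ (with $\mathbf{S}^5_\epsilon$ a small sphere about the origin); it is well known that its fundamental group has the presentation displayed in the claim, which may be taken as the description of the group. *)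

(* Defs.v *)
From HB Require Import structures.
From mathcomp Require Import all_boot all_order all_algebra.
From mathcomp Require Import boolp reals complex.

Set Implicit Arguments.
Unset Strict Implicit.
Unset Printing Implicit Defensive.

Import Order.TTheory GRing.Theory Num.Theory.

Local Open Scope quotient_scope.
Local Open Scope ring_scope.

(** The group presented by generators [X] and relations [Rel] (where [Rel s t]
    imposes s = t) is the type of formal group expressions over [X] modulo the
    smallest congruence that contains [Rel] and satisfies the group axioms. *)

Inductive gterm (X : Type) : Type :=
| GGen of X
| GOne
| GMul of gterm X & gterm X
| GInv of gterm X.

Arguments GOne {X}.

HB.instance Definition _ (X : Type) := gen_eqMixin (gterm X).
HB.instance Definition _ (X : Type) := gen_choiceMixin (gterm X).

Fixpoint gexpn (X : Type) (s : gterm X) (n : nat) : gterm X :=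
  if n is m.+1 then GMul s (gexpn s m) else GOne.

Definition gexpz (X : Type) (s : gterm X) (n : int) : gterm X :=
  match n with
  | Posz m => gexpn s m
  | Negz m => GInv (gexpn s m.+1)
  end.

Inductive pres_eq (X : Type) (Rel : gterm X -> gterm X -> Prop) :
    gterm X -> gterm X -> Prop :=
| pres_rel s t : Rel s t -> pres_eq Rel s t
| pres_refl s : pres_eq Rel s s
| pres_sym s t : pres_eq Rel s t -> pres_eq Rel t s
| pres_trans s t u : pres_eq Rel s t -> pres_eq Rel t u -> pres_eq Rel s u
| pres_mul s s' t t' : pres_eq Rel s s' -> pres_eq Rel t t' ->
    pres_eq Rel (GMul s t) (GMul s' t')
| pres_inv s s' : pres_eq Rel s s' -> pres_eq Rel (GInv s) (GInv s')
| pres_mulA s t u : pres_eq Rel (GMul s (GMul t u)) (GMul (GMul s t) u)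
| pres_mul1 s : pres_eq Rel (GMul GOne s) s
| pres_mulr1 s : pres_eq Rel (GMul s GOne) s
| pres_mulV s : pres_eq Rel (GMul (GInv s) s) GOne
| pres_mulrV s : pres_eq Rel (GMul s (GInv s)) GOne.

Section PresentedGroup.
Variables (X : Type) (Rel : gterm X -> gterm X -> Prop).

Definition pres_eqb : rel (gterm X) := fun s t => `[< pres_eq Rel s t >].

Fact pres_eqb_refl : reflexive pres_eqb.
Proof. by move=> s; apply/asboolP; exact: pres_refl. Qed.

Fact pres_eqb_sym : symmetric pres_eqb.
Proof. by move=> s t; apply/asboolP/asboolP; exact: pres_sym. Qed.

Fact pres_eqb_trans : transitive pres_eqb.
Proof.
by move=> t s u /asboolP st /asboolP tu; apply/asboolP; exact: pres_trans tu.
Qed.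

Canonical pres_equiv := EquivRel pres_eqb pres_eqb_refl pres_eqb_sym pres_eqb_trans.

Definition presented_group : Type := {eq_quot pres_equiv}.

HB.instance Definition _ := Choice.copy presented_group {eq_quot pres_equiv}.

Definition pres_class (s : gterm X) : presented_group :=
  \pi_({eq_quot pres_equiv}) s.

Definition pres_repr (u : presented_group) : gterm X :=
  repr (u : {eq_quot pres_equiv}).

Lemma pres_reprK u : pres_class (pres_repr u) = u.
Proof. exact: (@reprK _ {eq_quot pres_equiv}). Qed.

Lemma pres_classP s t : pres_class s = pres_class t <-> pres_eq Rel s t.
Proof.
split=> [/(@eqmodP _ pres_equiv)/asboolP //|st].
by apply/(@eqmodP _ pres_equiv)/asboolP.
Qed.

Lemma pres_class_repr s : pres_eq Rel (pres_repr (pres_class s)) s.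
Proof. by apply/pres_classP; rewrite pres_reprK. Qed.

Definition pres_one : presented_group := pres_class GOne.
Definition pres_inverse (u : presented_group) : presented_group :=
  pres_class (GInv (pres_repr u)).
Definition pres_product (u v : presented_group) : presented_group :=
  pres_class (GMul (pres_repr u) (pres_repr v)).

Lemma pres_class_mul s t :
  pres_product (pres_class s) (pres_class t) = pres_class (GMul s t).
Proof. by apply/pres_classP/pres_mul; exact: pres_class_repr. Qed.

Lemma pres_class_inv s : pres_inverse (pres_class s) = pres_class (GInv s).
Proof. by apply/pres_classP/pres_inv/pres_class_repr. Qed.

Fact pres_productA : associative pres_product.
Proof.
move=> u v w; rewrite -(pres_reprK u) -(pres_reprK v) -(pres_reprK w).
by rewrite !pres_class_mul; apply/pres_classP/pres_mulA.
Qed.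

Fact pres_product1 : left_id pres_one pres_product.
Proof.
by move=> u; rewrite -(pres_reprK u) pres_class_mul; apply/pres_classP/pres_mul1.
Qed.

Fact pres_productr1 : right_id pres_one pres_product.
Proof.
by move=> u; rewrite -(pres_reprK u) pres_class_mul; apply/pres_classP/pres_mulr1.
Qed.

Fact pres_productV : left_inverse pres_one pres_inverse pres_product.
Proof.
move=> u; rewrite -(pres_reprK u) pres_class_inv pres_class_mul.
exact/pres_classP/pres_mulV.
Qed.

Fact pres_productrV : right_inverse pres_one pres_inverse pres_product.
Proof.
move=> u; rewrite -(pres_reprK u) pres_class_inv pres_class_mul.
exact/pres_classP/pres_mulrV.
Qed.

HB.instance Definition _ := isGroup.Build presented_group
  pres_productA pres_product1 pres_productr1 pres_productV pres_productrV.

Definition pres_gen (g : X) : presented_group := pres_class (GGen g).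

End PresentedGroup.

Inductive brieskorn_gen := gen_x | gen_y | gen_z | gen_h.

(** In [rel_central], commuting with the four generators is what "h central"
    amounts to as a set of defining relations. *)
Inductive brieskorn_rel (p q r : nat) (a b c : int) :
    gterm brieskorn_gen -> gterm brieskorn_gen -> Prop :=
| rel_central g : brieskorn_rel p q r a b c
    (GMul (GGen gen_h) (GGen g)) (GMul (GGen g) (GGen gen_h))
| rel_x : brieskorn_rel p q r a b c
    (GMul (gexpn (GGen gen_x) p) (gexpz (GGen gen_h) a)) GOne
| rel_y : brieskorn_rel p q r a b c
    (GMul (gexpn (GGen gen_y) q) (gexpz (GGen gen_h) b)) GOne
| rel_z : brieskorn_rel p q r a b c
    (GMul (gexpn (GGen gen_z) r) (gexpz (GGen gen_h) c)) GOne
| rel_xyz : brieskorn_rel p q r a b c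
    (GMul (GMul (GGen gen_x) (GGen gen_y)) (GGen gen_z)) GOne.

(** The fundamental group of the Brieskorn homology sphere Sigma(p,q,r), through
    its standard presentation. *)
Notation brieskorn_pi1 p q r a b c :=
  (presented_group (brieskorn_rel p q r a b c)).

Definition pi1_x p q r a b c : brieskorn_pi1 p q r a b c := pres_gen _ gen_x.
Definition pi1_y p q r a b c : brieskorn_pi1 p q r a b c := pres_gen _ gen_y.
Definition pi1_h p q r a b c : brieskorn_pi1 p q r a b c := pres_gen _ gen_h.

Section SU21.
Variable R : realType.
Local Notation C := R[i].

(** [0], [1], [2] are the ring constants of ['I_3], i.e. the three coordinates. *)
Definition herm21 (Z W : 'cV[C]_3) : C :=
  Z 0 0 * (W 0 0)^* + Z 1 0 * (W 1 0)^* - Z 2 0 * (W 2 0)^*.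

Definition in_SU21 (A : 'M[C]_3) : Prop :=
  \det A = 1 /\ forall Z W, herm21 (A *m Z) (A *m W) = herm21 Z W.

Definition SU21_pred : pred 'M[C]_3 := fun A => `[< in_SU21 A >].

Record SU21 := MkSU21 { SU21_mx :> 'M[C]_3; SU21_mxP : SU21_pred SU21_mx }.

HB.instance Definition _ := [isSub for SU21_mx].
HB.instance Definition _ := [Choice of SU21 by <:].

Fact SU21_in (A : SU21) : in_SU21 A.
Proof. exact/asboolP/SU21_mxP. Qed.

Fact SU21_unit (A : SU21) : (A : 'M_3) \in unitmx.
Proof. by have [detA _] := SU21_in A; rewrite unitmxE detA unitr1. Qed.

Fact SU21_one_subproof : SU21_pred 1%:M.
Proof. by apply/asboolP; split=> [|Z W]; rewrite ?det1 ?mul1mx. Qed.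

Fact SU21_mul_subproof (A B : SU21) : SU21_pred (A *m B).
Proof.
have [[dA hA] [dB hB]] := (SU21_in A, SU21_in B).
apply/asboolP; split=> [|Z W]; first by rewrite det_mulmx dA dB mulr1.
by rewrite -!mulmxA hA hB.
Qed.

Fact SU21_inv_subproof (A : SU21) : SU21_pred (invmx A).
Proof.
have [dA hA] := SU21_in A.
apply/asboolP; split=> [|Z W]; first by rewrite det_inv dA invr1.
by rewrite -hA !mulKVmx ?SU21_unit.
Qed.

Definition SU21_one := MkSU21 SU21_one_subproof.
Definition SU21_mul A B := MkSU21 (SU21_mul_subproof A B).
Definition SU21_inv A := MkSU21 (SU21_inv_subproof A).

Fact SU21_mulA : associative SU21_mul.
Proof. by move=> A B D; apply: val_inj; exact: mulmxA. Qed.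
Fact SU21_mul1 : left_id SU21_one SU21_mul.
Proof. by move=> A; apply: val_inj; exact: mul1mx. Qed.
Fact SU21_mulr1 : right_id SU21_one SU21_mul.
Proof. by move=> A; apply: val_inj; exact: mulmx1. Qed.
Fact SU21_mulV : left_inverse SU21_one SU21_inv SU21_mul.
Proof. by move=> A; apply: val_inj; exact/mulVmx/SU21_unit. Qed.
Fact SU21_mulrV : right_inverse SU21_one SU21_inv SU21_mul.
Proof. by move=> A; apply: val_inj; exact/mulmxV/SU21_unit. Qed.

HB.instance Definition _ := isGroup.Build SU21
  SU21_mulA SU21_mul1 SU21_mulr1 SU21_mulV SU21_mulrV.

Definition irreducible_rep (G : groupType) (rho : G -> SU21) : Prop :=
  forall U : {vspace 'cV[C]_3},
    (forall (g : G) (v : 'cV[C]_3), v \in U -> (rho g : 'M_3) *m v \in U) ->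
    U = 0%VS \/ U = fullv.

Definition conjugate_in (A B : SU21) : Prop :=
  exists g : SU21, B = (g * A * g^-1)%g.

Definition conjugate_rep (G : groupType) (rho rho' : G -> SU21) : Prop :=
  exists g : SU21, forall w : G, rho' w = (g * rho w * g^-1)%g.

Definition mxtr (A : SU21) : C := \tr (A : 'M[C]_3).

End SU21.

(* Main.v *)
Require Import Defs.
From mathcomp Require Import all_boot all_order all_algebra.
From mathcomp Require Import separable cyclotomic boolp reals complex ring.

Set Implicit Arguments.
Unset Strict Implicit.
Unset Printing Implicit Defensive.

Import GRing.Theory Num.Theory.
Local Open Scope ring_scope.

Local Notation "A ^*t" := (map_mx Num.conj A^T) (at level 2).

(** By Schur's lemma [rho h] is a cube root of unity times the identity, so
    [A := rho x] and [B := rho y] have finite order and determine [rho]. Two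
    planes of [C^3] meet, so by irreducibility [A] or [B] has three distinct
    eigenvalues, and the data are symmetric in [A] and [B]. Say [A] does, and
    take an eigenbasis of [A]: it is orthogonal for the Hermitian form, since
    the eigenvalues [a_i] are distinct of modulus 1. The traces of [B], [A B]
    and [A^-1 B] give the diagonal of [B] by a Vandermonde argument. Expanding
    [det B = 1] along rows and columns leaves one real degree of freedom for
    the moduli of the other entries, and [Im tr [A, B]] fixes it. Unitarity
    expresses the cofactors of [B] by its entries, so the products of entries
    of [B] along 2- and 3-cycles are determined as well; hence [B] is
    determined up to conjugation by a diagonal unitary matrix, which commutes
    with [A] and, once rescaled, lies in [SU(2,1)]. *)

(** * Indices, cofactors and linear systems in dimension three *)

Lemma mem_uniq3 (i j k : 'I_3) : uniq [:: i; j; k] -> [:: i; j; k] =i 'I_3.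
Proof.
move=> /card_uniqP card_ijk; apply/subset_cardP; last exact: subset_predT.
by rewrite card_ijk card_ord.
Qed.

Lemma uniq3_ind (P : 'I_3 -> Prop) (i j k : 'I_3) :
  uniq [:: i; j; k] -> P i -> P j -> P k -> forall l, P l.
Proof.
move=> /mem_uniq3 ijk Pi Pj Pk l; have : l \in [:: i; j; k] by rewrite ijk.
by rewrite !inE => /or3P[] /eqP->.
Qed.

Lemma big_uniq3 (V : nmodType) (F : 'I_3 -> V) (i j k : 'I_3) :
  uniq [:: i; j; k] -> \sum_l F l = F i + F j + F k.
Proof.
move=> ijk; transitivity (\sum_(l <- [:: i; j; k]) F l).
  by rewrite (big_uniq _ ijk); apply: eq_bigl => l; rewrite mem_uniq3.
by rewrite !big_cons big_nil addr0 addrA.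
Qed.

Lemma uniq3_third (i j : 'I_3) : i != j -> exists k, uniq [:: i; j; k].
Proof.
by case: i j => [[|[|[|//]]] ?] [[|[|[|//]]] ?] //= _;
  [exists 2|exists 1|exists 2|exists 0|exists 1|exists 0].
Qed.

Lemma det_mx22 (K : comNzRingType) (M : 'M[K]_2) :
  \det M = M 0 0 * M 1 1 - M 0 1 * M 1 0.
Proof.
rewrite (expand_det_row M 0) !big_ord_recl big_ord0 /cofactor !det_mx11 !mxE.
rewrite /= ?expr0 ?expr1 !mul1r !mulN1r addr0 mulrN.
by congr (M _ _ * M _ _ - M _ _ * M _ _); apply/val_inj.
Qed.

Lemma cofactor3 (K : comNzRingType) (A : 'M[K]_3) (i j k : 'I_3) :
  uniq [:: i; j; k] ->
  cofactor A i i = A j j * A k k - A j k * A k j /\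
  cofactor A i j = A j k * A k i - A j i * A k k.
Proof.
(* Reading entries through natural numbers makes indices that differ only in their bound proofs
   agree. *)
have [f fE] : exists f : nat -> nat -> K, forall m n, A m n = f m n.
  by exists (fun m n => A (inord m) (inord n)) => m n; rewrite !inord_val.
rewrite /cofactor !det_mx22 !mxE !fE /=.
by case: i j k => [[|[|[|//]]] ?] [[|[|[|//]]] ?] [[|[|[|//]]] ?] //= _;
  rewrite /bump /= ?modn_small //=; split; ring.
Qed.

(** The second equation, minus [a j + a k] times the first, plus [a j * a k] times the third,
    cancels [x j] and [x k]; multiplied by [a i], it leaves [(a i - a j) * (a i - a k) * x i]. *)
Lemma vandermonde3_eq0 (K : fieldType) (a x : 'I_3 -> K) :
  injective a -> (forall i, a i != 0) ->
  \sum_i x i = 0 -> \sum_i a i * x i = 0 -> \sum_i (a i)^-1 * x i = 0 ->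
  forall i, x i = 0.
Proof.
move=> a_inj a0 e1 e2 e3.
suff x0 (i j k : 'I_3) : uniq [:: i; j; k] -> x i = 0.
  by apply: (@uniq3_ind _ 0 1 2);
    [| exact: (x0 0 1 2) | exact: (x0 1 0 2) | exact: (x0 2 0 1)].
move=> ijk; move: e1 e2 e3; rewrite !(big_uniq3 _ ijk) => e1 e2 e3.
have [aij aik] : a i - a j != 0 /\ a i - a k != 0.
  rewrite !subr_eq0 !(inj_eq a_inj).
  by move: ijk; rewrite /= !inE negb_or => /andP[/andP[-> ->]].
apply/eqP; rewrite -(mulrI_eq0 _ (mulfI aij)) -(mulrI_eq0 _ (mulfI aik)); apply/eqP.
transitivity (a i * ((a i * x i + a j * x j + a k * x k)
  - (a j + a k) * (x i + x j + x k)
  + a j * a k * ((a i)^-1 * x i + (a j)^-1 * x j + (a k)^-1 * x k))).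
  by field; rewrite !a0.
by rewrite e1 e2 e3; ring.
Qed.

Lemma conjC_norm1 (C : numClosedFieldType) (z : C) : `|z| = 1 -> z^* = z^-1.
Proof.
move=> z1; have z0 : z != 0 by rewrite -normr_eq0 z1 oner_eq0.
by apply: (mulfI z0); rewrite mulfV // -normCK z1 expr1n.
Qed.

(* A 3 x 3 matrix with zero diagonal, row sums and column sums is a multiple of
   the antisymmetric circulant, and for this circulant the twisted sum is
   (a 0 - a 1)(a 1 - a 2)(a 2 - a 0) / (a 0 a 1 a 2), up to sign. *)
Lemma circulant_eq0 (C : numClosedFieldType) (a : 'I_3 -> C) (w : 'I_3 -> 'I_3 -> C) :
  injective a -> (forall i, `|a i| = 1) ->
  (forall i j, (w i j)^* = w i j) -> (forall i, w i i = 0) ->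
  (forall i, \sum_j w i j = 0) -> (forall j, \sum_i w i j = 0) ->
  'Im (\sum_i \sum_j a i / a j * w i j) = 0 ->
  forall i j, w i j = 0.
Proof.
move=> a_inj a1 w_real w_diag w_row w_col Im0.
have a0 i : a i != 0 by rewrite -normr_eq0 a1 oner_eq0.
have u : uniq [:: 0; 1; 2 : 'I_3] by [].
(* Vanishing imaginary part is turned into equality with the conjugate, where each [a i / a j]
   becomes [a j / a i] because the [a i] have modulus 1. *)
have /eqP : (\sum_i \sum_j a i / a j * w i j) = (\sum_i \sum_j a i / a j * w i j)^*.
  by apply/esym/CrealP/Creal_ImP.
rewrite rmorph_sum; under [X in _ == X]eq_bigr => i _.
  rewrite rmorph_sum; under eq_bigr => j _.
    rewrite !rmorphM fmorphV /= w_real !conjC_norm1 // invrK; over.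
  over.
move: (w_row 0) (w_row 1) (w_row 2) (w_col 0) (w_col 1) (w_col 2).
rewrite !(big_uniq3 _ u) !w_diag => r0 r1 r2 c0 c1 c2.
have w02 : w 0 2 = - w 0 1.
  by apply/eqP; rewrite -addr_eq0; apply/eqP; rewrite -[RHS]r0; ring.
have w21 : w 2 1 = - w 0 1.
  by apply/eqP; rewrite -addr_eq0; apply/eqP; rewrite -[RHS]c1; ring.
have w12 : w 1 2 = w 0 1.
  by apply/eqP; rewrite -subr_eq0; apply/eqP; rewrite -[RHS]c2 w02; ring.
have w10 : w 1 0 = - w 0 1.
  by apply/eqP; rewrite -addr_eq0; apply/eqP; rewrite -[RHS]r1 w12; ring.
have w20 : w 2 0 = w 0 1.
  by apply/eqP; rewrite -subr_eq0; apply/eqP; rewrite -[RHS]c0 w10; ring.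
rewrite w02 w21 w12 w10 w20 => /eqP tk.
suff w01 : w 0 1 = 0.
  by apply: (@uniq3_ind _ 0 1 2) => //; apply: (@uniq3_ind _ 0 1 2) => //;
    rewrite ?w02 ?w21 ?w12 ?w10 ?w20 w01 ?oppr0.
have a_neq i j : i != j -> a i - a j != 0 by rewrite subr_eq0 (inj_eq a_inj).
(* Up to sign, this constant times [w 0 1] is the twisted sum minus its conjugate. Conjugation
   negates the sum, whence the factor 2. *)
have k0 : 2 * (a 0 - a 1) * (a 1 - a 2) * (a 0 - a 2) / (a 0 * a 1 * a 2) != 0.
  by rewrite !mulf_neq0 ?invr_eq0 ?mulf_neq0 ?a_neq ?a0 // pnatr_eq0.
apply: (mulfI k0); rewrite mulr0.
move/eqP: tk; rewrite -subr_eq0 => /eqP tk.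
by rewrite -[RHS]oppr0 -[in RHS]tk; field; rewrite !a0.
Qed.

(** * Recovering a matrix up to diagonal conjugation *)

(** View the nonzero off-diagonal entries of [B] as edges of a directed graph. Each of the three
    vertices has an edge out and an edge in, so there is a 3-cycle or a pair of 2-cycles sharing a
    vertex [i]. Normalize [d i = 1], read the other two phases off these edges, and let the cycle
    products give the remaining entries. *)
Lemma cycle_products_diag_similar (C : numClosedFieldType) (B B' : 'M[C]_3) :
  (forall i, B' i i = B i i) -> (forall i j, `|B' i j| = `|B i j|) ->
  (forall i j, B' i j * B' j i = B i j * B j i) ->
  (forall i j k, uniq [:: i; j; k] ->
    B' i j * B' j k * B' k i = B i j * B j k * B k i) ->
  (forall i, exists2 j, j != i & B i j != 0) ->
  (forall i, exists2 j, j != i & B j i != 0) ->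
  exists d : 'I_3 -> C, (forall i, `|d i| = 1) /\
    forall i j, B' i j = d i * B i j / d j.
Proof.
move=> dia nrm cyc2 cyc3 out inn.
have B'0 i j : (B' i j == 0) = (B i j == 0) by rewrite -normr_eq0 nrm normr_eq0.
have [i [j [k [ijk nz]]]] : exists i j k, uniq [:: i; j; k] /\
    ([&& B i j != 0, B j k != 0 & B k i != 0] \/
     [&& B i j != 0, B j i != 0, B i k != 0 & B k i != 0]).
  have out3 i j k : uniq [:: i; j; k] -> (B i j != 0) || (B i k != 0).
    move=> ijk; have [l] := out i; have: l \in [:: i; j; k] by rewrite mem_uniq3.
    by rewrite !inE => /or3P[]/eqP->; rewrite ?eqxx // => _ ->; rewrite ?orbT.
  have inn3 i j k : uniq [:: i; j; k] -> (B j i != 0) || (B k i != 0).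
    move=> ijk; have [l] := inn i; have: l \in [:: i; j; k] by rewrite mem_uniq3.
    by rewrite !inE => /or3P[]/eqP->; rewrite ?eqxx // => _ ->; rewrite ?orbT.
  have : [|| [&& B 0 1 != 0, B 1 2 != 0 & B 2 0 != 0],
             [&& B 0 2 != 0, B 2 1 != 0 & B 1 0 != 0],
             [&& B 0 1 != 0, B 1 0 != 0, B 0 2 != 0 & B 2 0 != 0],
             [&& B 1 0 != 0, B 0 1 != 0, B 1 2 != 0 & B 2 1 != 0] |
             [&& B 2 0 != 0, B 0 2 != 0, B 2 1 != 0 & B 1 2 != 0]].
    move: (out3 0 1 2 isT) (out3 1 0 2 isT) (out3 2 0 1 isT).
    move: (inn3 0 1 2 isT) (inn3 1 0 2 isT) (inn3 2 0 1 isT).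
    move: (B 0 1 != 0) (B 0 2 != 0) (B 1 0 != 0) (B 1 2 != 0) (B 2 0 != 0) (B 2 1 != 0).
    by do 6!case.
  case/or4P => [h|h|h|/orP[h|h]]; [exists 0, 1, 2|exists 0, 2, 1|exists 0, 1, 2
    |exists 1, 0, 2|exists 2, 0, 1]; by split; [|rewrite h ?orbT; auto].
(* Here [s] and [t] stand for [d j] and [d k]. *)
have [s [t [s1 t1 [ij ji ik ki [jk kj]]]]] : exists s t : C, [/\ `|s| = 1, `|t| = 1 &
    [/\ B' i j = B i j / s, B' j i = s * B j i, B' i k = B i k / t,
        B' k i = t * B k i & B' j k = s * B j k / t /\ B' k j = t * B k j / s]].
  have nz' m n : B m n != 0 -> B' m n != 0 by rewrite B'0.
  have unit_div m n : B m n != 0 -> `|B m n / B' m n| = 1.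
    by move=> Bmn; rewrite normf_div nrm divff // normr_eq0.
  have mul_eq (x y z : C) : x != 0 -> x * y = x * z -> y = z by move/mulfI; apply.
  have [[Cij Cik] Cjk] := (cyc2 i j, cyc2 i k, cyc2 j k).
  have Cijk := cyc3 i j k ijk.
  case: nz => [/and3P[Bij Bjk Bki]|/and4P[Bij Bji Bik Bki]].
  - have [[Bij' Bjk'] Bki'] := (nz' _ _ Bij, nz' _ _ Bjk, nz' _ _ Bki).
    (* For a 3-cycle, the phases are accumulated along the path from [i] to [j] to [k]; the 3-cycle
       product handles the closing edge. *)
    exists (B i j / B' i j), (B i j / B' i j * (B j k / B' j k)).
    have [s1 t1] := (unit_div _ _ Bij, unit_div _ _ Bjk).
    split; [exact: s1 | by rewrite normrM s1 t1 mulr1 |].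
    have tki : B' k i = B i j / B' i j * (B j k / B' j k) * B k i.
      apply: (mul_eq (B' i j * B' j k)); first by rewrite mulf_neq0.
      by rewrite Cijk; field; rewrite ?Bij' ?Bjk'.
    split; last split.
    + by field; rewrite ?Bij ?Bij'.
    + by apply: (mul_eq (B' i j)) => //; rewrite Cij; field.
    + apply: (mul_eq (B' k i)) => //; rewrite mulrC Cik {1}tki.
      by field; rewrite ?Bij ?Bjk ?Bij' ?Bjk'.
    + exact: tki.
    + by field; rewrite ?Bij ?Bjk ?Bij' ?Bjk'.
    + by apply: (mul_eq (B' j k)) => //; rewrite Cjk; field; rewrite ?Bij ?Bij' ?Bjk'.
  - have [[[Bij' Bji'] Bik'] Bki'] := (nz' _ _ Bij, nz' _ _ Bji, nz' _ _ Bik, nz' _ _ Bki).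
    (* For two 2-cycles through [i], the entries between [j] and [k] come from the 3-cycle products
       of the two orientations. *)
    exists (B i j / B' i j), (B i k / B' i k); rewrite !unit_div //; split=> //.
    have tki : B' k i = B i k / B' i k * B k i.
      by apply: (mul_eq (B' i k)) => //; rewrite Cik; field.
    have sji : B' j i = B i j / B' i j * B j i.
      by apply: (mul_eq (B' i j)) => //; rewrite Cij; field.
    split=> //; last split.
    + by field; rewrite ?Bij ?Bij'.
    + by field; rewrite ?Bik ?Bik'.
    + apply: (mul_eq (B' i j * B' k i)); first by rewrite mulf_neq0.
      by rewrite mulrAC Cijk tki; field; rewrite ?Bij ?Bik ?Bij' ?Bik'.
    + have ikj : uniq [:: i; k; j].
        by move: ijk; rewrite /= !inE !negb_or !andbT (eq_sym k j) => /andP[/andP[-> ->] ->].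
      apply: (mul_eq (B' i k * B' j i)); first by rewrite mulf_neq0.
      by rewrite mulrAC (cyc3 _ _ _ ikj) sji; field; rewrite ?Bij ?Bik ?Bij' ?Bik'.
have [ji' ki' kj'] : [/\ j == i = false, k == i = false & k == j = false].
  by move: ijk; rewrite /= !inE negb_or => /andP[/andP[/negPf ij' /negPf ik'] /andP[/negPf jk' _]];
    rewrite eq_sym ij' eq_sym ik' eq_sym jk'.
exists (fun l => if l == i then 1 else if l == j then s else t); split.
  by move=> l; case: ifP => _; rewrite ?normr1 //; case: ifP.
by apply: (uniq3_ind ijk); apply: (uniq3_ind ijk);
  rewrite ?ji' ?ki' ?kj' ?eqxx ?dia ?divr1 ?mul1r ?ij ?ji ?ik ?ki ?jk ?kj // mulrAC divff ?mul1r //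
    -normr_eq0 ?s1 ?t1 oner_eq0.
Qed.

(* [B^-1 = G^-1 B^* G] for [G = diag n], written with the cofactors of [B]. *)
Definition diag_special_unitary (C : numClosedFieldType) (n : 'I_3 -> C)
    (B : 'M[C]_3) : Prop :=
  \det B = 1 /\ forall i j, (B i j)^* * n i = n j * cofactor B i j.

(** Here [a] lists the eigenvalues of a diagonal matrix A. As the inverse of [B] is its adjugate,
    the double sum is the trace of [A, B]. The hypothesis on columns says that no basis vector is an
    eigenvector of [B]. *)
Lemma traces_diag_similar (C : numClosedFieldType) (n a : 'I_3 -> C)
    (B B' : 'M[C]_3) :
  (forall i, n i != 0) -> (forall i, (n i)^* = n i) ->
  injective a -> (forall i, `|a i| = 1) ->
  diag_special_unitary n B -> diag_special_unitary n B' ->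
  (forall i, exists2 j, j != i & B j i != 0) ->
  \sum_i B i i = \sum_i B' i i ->
  \sum_i a i * B i i = \sum_i a i * B' i i ->
  \sum_i (a i)^-1 * B i i = \sum_i (a i)^-1 * B' i i ->
  'Im (\sum_i \sum_j a i / a j * (B i j * cofactor B i j)) =
  'Im (\sum_i \sum_j a i / a j * (B' i j * cofactor B' i j)) ->
  exists d : 'I_3 -> C, (forall i, `|d i| = 1) /\
    forall i j, B' i j = d i * B i j / d j.
Proof.
move=> n0 n_real a_inj a1 [detB cofB] [detB' cofB'] inn tr1 tra trV trC.
have a0 i : a i != 0 by rewrite -normr_eq0 a1 oner_eq0.
have BB' i : B' i i = B i i.
  apply/eqP; rewrite -subr_eq0; apply/eqP; move: i.
  apply: (vandermonde3_eq0 a_inj a0).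
  - by rewrite sumrB tr1 subrr.
  - by under eq_bigr do rewrite mulrBr; rewrite sumrB tra subrr.
  - by under eq_bigr do rewrite mulrBr; rewrite sumrB trV subrr.
have cofE (M : 'M[C]_3) i j : (M i j)^* * n i = n j * cofactor M i j ->
    cofactor M i j = (M i j)^* * n i / n j.
  by move=> ->; rewrite mulrAC divff ?mul1r.
have cofBE i j := cofE _ _ _ (cofB i j).
have cofB'E i j := cofE _ _ _ (cofB' i j).
have weightE (M : 'M[C]_3) i j : (M i j)^* * n i = n j * cofactor M i j ->
    M i j * cofactor M i j = `|M i j| ^+ 2 * n i / n j.
  by move=> /cofE->; rewrite normCK !mulrA.
(* The differences of these weights are real by [weightE], vanish on the diagonal because the
   diagonals of [B] and [B'] agree, and have zero row and column sums by Laplace expansion of the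
   two determinants. *)
have weightBB' i j : B' i j * cofactor B' i j = B i j * cofactor B i j.
  apply/eqP; rewrite -subr_eq0; apply/eqP; move: i j.
  apply: (circulant_eq0 a_inj a1) => [i j|i|i|j|].
  - rewrite (weightE _ _ _ (cofB _ _)) (weightE _ _ _ (cofB' _ _)).
    by rewrite rmorphB !rmorphM !fmorphV /= !n_real !conj_normC.
  - by rewrite cofBE cofB'E BB' subrr.
  - by rewrite sumrB -!expand_det_row detB detB' subrr.
  - by rewrite sumrB -!expand_det_col detB detB' subrr.
  - under eq_bigr do (under eq_bigr do rewrite mulrBr; rewrite sumrB).
    by rewrite sumrB raddfB /= trC subrr.
have normBB' i j : `|B' i j| = `|B i j|.
  apply/eqP; rewrite -(eqrXn2 (_ : 0 < 2)%N) //; apply/eqP.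
  apply: (mulIf (n0 i)); apply: (mulIf (_ : (n j)^-1 != 0)); first by rewrite invr_eq0.
  by rewrite -(weightE _ _ _ (cofB _ _)) -(weightE _ _ _ (cofB' _ _)).
(* The 2-cycle product is what remains unknown in the diagonal cofactor at the third index. *)
have cyc2 i j : B' i j * B' j i = B i j * B j i.
  have [->|/uniq3_third[k ijk]] := eqVneq i j; first by rewrite !BB'.
  have kij : uniq [:: k; i; j].
    by move: ijk; rewrite /= !inE !negb_or !andbT !(eq_sym k) andbC => /andP[-> /andP[-> ->]].
  have : cofactor B' k k = cofactor B k k by rewrite cofBE cofB'E BB'.
  rewrite (cofactor3 B kij).1 (cofactor3 B' kij).1 !BB'.
  by move/addrI/oppr_inj.
(* The weight at [i], [j] is this 3-cycle product minus a 2-cycle product times a diagonal entry. *)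
have cyc3 i j k : uniq [:: i; j; k] ->
    B' i j * B' j k * B' k i = B i j * B j k * B k i.
  move=> ijk; move: (weightBB' i j).
  rewrite (cofactor3 B ijk).2 (cofactor3 B' ijk).2 !mulrBr !mulrA cyc2 BB'.
  by move/addIr.
apply: cycle_products_diag_similar => // i.
(* A row [i] of [B] supported on the diagonal gives, by unitarity, a column [i]
   of [B] supported on the diagonal. *)
case: (pickP [pred j | (j != i) && (B i j != 0)]) => [j /andP[ji Bij]|row0].
  by exists j.
have Bij j : j != i -> B i j = 0.
  by move=> ji; apply/eqP; move: (row0 j); rewrite /= ji => /negbFE.
have cof0 j : j != i -> cofactor B i j = 0.
  by move=> ji; rewrite cofBE Bij // conjC0 !mul0r.
have [k ki /negP[]] := inn i; apply/eqP.
have /(congr1 (fun M : 'M_3 => M k i)) := mul_mx_adj B.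
rewrite !mxE (negPf ki) mulr0n (bigD1 i) //= big1 => [|j /cof0 ji]; last first.
  by rewrite mxE ji mulr0.
rewrite addr0 mxE => /eqP; rewrite mulf_eq0 => /orP[/eqP//|/eqP cofii].
move: detB; rewrite (expand_det_row B i) big1 => [/eqP|j _].
  by rewrite eq_sym oner_eq0.
by have [->|/cof0->] := eqVneq j i; rewrite ?cofii mulr0.
Qed.

(** * Unitary matrices of a Hermitian form, seen in an eigenbasis *)

Section HermitianForm.
Variable C : numClosedFieldType.

Lemma ctmxM m n p (A : 'M[C]_(m, n)) (B : 'M[C]_(n, p)) :
  (A *m B)^*t = B^*t *m A^*t.
Proof. by rewrite trmx_mul map_mxM. Qed.

Lemma ctmxK m n (A : 'M[C]_(m, n)) : (A^*t)^*t = A.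
Proof. by apply/matrixP => i j; rewrite !mxE conjCK. Qed.

(** The minimal polynomial divides X^n - 1, which is separable and split over [C]; the eigenvalues
    are n-th roots of unity. *)
Lemma finite_order_diagonalizable d (A : 'M[C]_d.+1) n :
  (0 < n)%N -> A ^+ n = 1 ->
  exists (P : 'M[C]_d.+1) (a : 'rV[C]_d.+1),
    [/\ P \in unitmx, A *m P = P *m diag_mx a & forall i, `|a 0 i| = 1].
Proof.
move=> n_gt0 An.
have hornerA : horner_mx A ('X^n - 1) = 0.
  by rewrite rmorphB rmorphXn /= horner_mx_X rmorph1 An subrr.
have sepX : separable_poly ('X^n - 1 : {poly C}).
  by apply: separable_Xn_sub_1; rewrite pnatr_eq0 -lt0n.
have [rs rsE] := closed_field_poly_normal ('X^n - 1 : {poly C}).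
rewrite (monicP (monicXnsubC _ n_gt0)) scale1r in rsE.
have [P Pu [a AP]] : exists2 P : 'M[C]_d.+1, P \in unitmx &
    exists a : 'rV[C]_d.+1, A *m P = P *m diag_mx a.
  have [|P Pu /diagonalizable_forPex[a /(mxpoly.simmxP Pu) PA]] :=
      (mxpoly.diagonalizableP A).2.
    exists rs; first by rewrite -separable_prod_XsubC -rsE.
    by rewrite -rsE mxminpoly_min.
  exists (invmx P); first by rewrite unitmx_inv.
  by exists a; rewrite -[LHS](mulKmx Pu) (mulmxA P) PA mulmxK.
exists P, a; split=> // i; apply/eqP; rewrite -(pexpr_eq1 n_gt0) // -normrX.
have AnP m : A ^+ m *m P = P *m diag_mx (\row_j a 0 j ^+ m).
  elim: m => [|m IHm].
    rewrite expr0 mul1mx; have -> : \row_j a 0 j ^+ 0 = const_mx 1.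
      by apply/rowP => j; rewrite !mxE.
    by rewrite diag_const_mx mulmx1.
  rewrite exprS -mulmxA IHm !mulmxA AP -mulmxA mulmx_diag.
  by congr (_ *m diag_mx _); apply/rowP => j; rewrite !mxE exprS.
move: (AnP n); rewrite An mul1mx -[LHS]mulmx1 => /(can_inj (mulKmx Pu)).
move/(congr1 (fun M : 'M_d.+1 => M i i)); rewrite !mxE eqxx !mulr1n => <-.
by rewrite normr1.
Qed.

Lemma mxtrace_similar d (P X x : 'M[C]_d) :
  P \in unitmx -> X *m P = P *m x -> \tr X = \tr x.
Proof. by move=> Pu XP; rewrite -[X](mulmxK Pu) XP mxtrace_mulC mulKmx. Qed.

Variable J : 'M[C]_3.
Hypothesis J_unit : J \in unitmx.
Hypothesis J_herm : J^*t = J.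

Definition special_unitary (M : 'M[C]_3) : Prop :=
  \det M = 1 /\ M^*t *m J *m M = J.

(** Taking determinants gives [\det M] modulus 1, so a cube root of its inverse is a scalar of
    modulus 1: it preserves the form and corrects the determinant. *)
Lemma unitary_normalize (M : 'M[C]_3) :
  M^*t *m J *m M = J -> exists2 c : C, c != 0 & special_unitary (c *: M).
Proof.
move=> hM.
have detM : `|\det M| = 1.
  have detJ : \det J != 0 by rewrite -unitfE -unitmxE.
  apply/eqP; rewrite -(pexpr_eq1 (n := 2)) // normCK; apply/eqP.
  apply: (mulfI detJ); rewrite mulr1 -[in RHS]hM !det_mulmx det_map_mx det_tr.
  by ring.
have c1 : `|3.-root (\det M)^-1| = 1 by rewrite norm_rootC normfV detM invr1 rootC1.
exists (3.-root (\det M)^-1); first by rewrite -normr_eq0 c1 oner_eq0.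
split; first by rewrite detZ rootCK // mulVf // -normr_eq0 detM oner_eq0.
move: (3.-root _) c1 => c c1.
have -> : (c *: M)^*t = c^* *: M^*t by apply/matrixP => i j; rewrite !mxE rmorphM.
by rewrite -!scalemxAl -scalemxAr scalerA hM mulrC -normCK c1 expr1n scale1r.
Qed.

Lemma special_unitary_pair_similar (A B B' P : 'M[C]_3) (a : 'rV[C]_3) :
  special_unitary A -> special_unitary B -> special_unitary B' ->
  P \in unitmx -> A *m P = P *m diag_mx a -> injective (a 0) ->
  (forall i, `|a 0 i| = 1) ->
  (forall (v : 'cV[C]_3) s t, A *m v = s *: v -> B *m v = t *: v -> v = 0) ->
  \tr B = \tr B' -> \tr (A *m B) = \tr (A *m B') ->
  \tr (invmx A *m B) = \tr (invmx A *m B') ->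
  'Im (\tr (A *m B *m invmx A *m invmx B)) =
    'Im (\tr (A *m B' *m invmx A *m invmx B')) ->
  exists g : 'M[C]_3,
    [/\ special_unitary g, g *m A = A *m g & g *m B = B' *m g].
Proof.
move=> suA suB suB' Pu AP a_inj a1 noeig trB trAB trAVB trcom.
have a0 i : a 0 i != 0 by rewrite -normr_eq0 a1 oner_eq0.
(* [G] is the Gram matrix of the eigenbasis of [A], and [b M] below is the matrix of [M] in that
   basis. *)
have [G GE] : exists G : 'M[C]_3, G = P^*t *m J *m P by eexists.
have [b bE] : exists b : 'M[C]_3 -> 'M[C]_3, forall M, M *m P = P *m b M.
  by exists (fun M => invmx P *m M *m P) => M; rewrite -mulmxA mulKVmx.
have detP : \det P != 0 by rewrite -unitfE -unitmxE.
have detb M : special_unitary M -> \det (b M) = 1.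
  move=> [detM _]; apply: (mulfI detP).
  by rewrite mulr1 -det_mulmx -bE det_mulmx detM mul1r.
have Gb M : special_unitary M -> (b M)^*t *m G *m b M = G.
  move=> [_ MJ]; rewrite GE !mulmxA -ctmxM -bE -mulmxA -bE ctmxM -[in RHS]MJ.
  by rewrite !mulmxA.
have bA : b A = diag_mx a by apply: (can_inj (mulKmx Pu)); rewrite -bE.
(* Invariance of [G] under [b A] reads [G i j = (a 0 i)^-1 * G i j * a 0 j], so a nonzero [G i j]
   forces equal eigenvalues. *)
have Goff i j : i != j -> G i j = 0.
  move=> ij; have /(congr1 (fun M : 'M_3 => M i j)) := Gb A suA.
  rewrite bA mul_mx_diag mxE tr_diag_mx map_diag_mx mul_diag_mx !mxE /=.
  rewrite conjC_norm1 // => Gij; apply/eqP; apply: contraR ij => Gij0.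
  apply/eqP/a_inj; apply: (mulfI Gij0).
  move/(congr1 ( *%R (a 0 i))): Gij; rewrite !mulrA mulfV // mul1r => ->.
  by rewrite mulrC.
have Gdiag : G = diag_mx (\row_i G i i).
  apply/matrixP => i j; rewrite [RHS]mxE mxE.
  by have [->|/Goff->] := eqVneq i j.
pose n i := G i i.
have n_real i : (n i)^* = n i.
  have Gct : G^*t = G by rewrite GE !ctmxM J_herm ctmxK mulmxA.
  by rewrite /n -[in RHS]Gct !mxE.
have n0 i : n i != 0.
  have : \det G != 0.
    by rewrite GE !det_mulmx det_map_mx det_tr !mulf_neq0 ?fmorph_eq0 //
      -unitfE -unitmxE.
  by rewrite Gdiag det_diag => /prodf_neq0/(_ i isT); rewrite mxE.
have sub M : special_unitary M -> diag_special_unitary n (b M).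
  move=> suM; split=> [|i j]; first exact: detb.
  (* Multiplying the invariance of [G] by the adjugate on the right puts cofactors in place of the
     inverse. *)
  have := congr1 (mulmx^~ (\adj (b M))) (Gb M suM).
  rewrite /= -(mulmxA _ (b M) (\adj _)) mul_mx_adj detb // mulmx1 {1}Gdiag [in RHS]Gdiag.
  rewrite mul_mx_diag mul_diag_mx => /(congr1 (fun M : 'M_3 => M j i)).
  by rewrite !mxE.
have bM M N : b (M *m N) = b M *m b N.
  by apply: (can_inj (mulKmx Pu)); rewrite -bE -(mulmxA M N) bE mulmxA bE -!mulmxA.
have b1 : b 1%:M = 1%:M.
  by apply: (can_inj (mulKmx Pu)); rewrite -bE mulmx1 mul1mx.
have bVK M : special_unitary M -> b (invmx M) *m b M = 1%:M.
  by move=> [detM _]; rewrite -bM mulVmx // unitmxE detM unitr1.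
have bV M : special_unitary M -> b (invmx M) = \adj (b M).
  by move=> suM; rewrite -[RHS]mul1mx -(bVK M suM) -mulmxA mul_mx_adj detb // mulmx1.
have bAV : b (invmx A) = diag_mx (map_mx GRing.inv a).
  rewrite -[RHS]mul1mx -(bVK A suA) bA -mulmxA mulmx_diag.
  rewrite (_ : \row_j _ = const_mx 1) ?diag_const_mx ?mulmx1 //.
  by apply/rowP => i; rewrite !mxE mulfV.
have trE M : \sum_i b M i i = \tr M by rewrite (mxtrace_similar Pu (bE M)).
have trAE M : \sum_i a 0 i * b M i i = \tr (A *m M).
  by rewrite -trE bM bA mul_diag_mx; apply: eq_bigr => i _; rewrite mxE.
have trAVE M : \sum_i (a 0 i)^-1 * b M i i = \tr (invmx A *m M).
  by rewrite -trE bM bAV mul_diag_mx; apply: eq_bigr => i _; rewrite !mxE.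
have trcomE M : special_unitary M ->
    \sum_i \sum_j a 0 i / a 0 j * (b M i j * cofactor (b M) i j) =
    \tr (A *m M *m invmx A *m invmx M).
  move=> suM; rewrite -trE !bM bA bAV bV // mul_diag_mx mul_mx_diag.
  apply: eq_bigr => i _; rewrite mxE; apply: eq_bigr => j _; rewrite !mxE.
  by rewrite -!mulrA; congr (_ * _); rewrite mulrCA.
have eigP M i : (forall j, j != i -> b M j i = 0) ->
    M *m (P *m delta_mx i 0 : 'cV_3) = b M i i *: (P *m delta_mx i 0).
  move=> Mi; rewrite mulmxA bE -mulmxA -colE scalemxAr; congr (_ *m _).
  apply/colP => j; rewrite !mxE andbT.
  by have [->|/Mi->] := eqVneq j i; rewrite ?mulr1 ?mulr0.
have inn i : exists2 j, j != i & b B j i != 0.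
  case: (pickP [pred j | (j != i) && (b B j i != 0)]) => [j /andP[ji Bji]|col0].
    by exists j.
  have Bi j : j != i -> b B j i = 0.
    by move=> ji; apply/eqP; move: (col0 j); rewrite /= ji => /negbFE.
  have Ai j : j != i -> b A j i = 0 by move=> ji; rewrite bA mxE (negPf ji).
  have /(congr1 (mulmx (invmx P))) := noeig _ _ _ (eigP A i Ai) (eigP B i Bi).
  rewrite mulKmx // mulmx0 => /colP/(_ i); rewrite !mxE !eqxx => /eqP.
  by rewrite oner_eq0.
have [||||d [d1 bB']] :=
    traces_diag_similar n0 n_real a_inj a1 (sub B suB) (sub B' suB') inn.
- by rewrite !trE.
- by rewrite !trAE.
- by rewrite !trAVE.
- by rewrite !trcomE.
have d0 i : d i != 0 by rewrite -normr_eq0 d1 oner_eq0.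
pose D : 'M[C]_3 := diag_mx (\row_i d i).
have DG : D^*t *m G *m D = G.
  rewrite /D {1}Gdiag tr_diag_mx map_diag_mx !mulmx_diag [RHS]Gdiag.
  congr diag_mx; apply/rowP => i; rewrite !mxE /= conjC_norm1 //.
  by rewrite mulrAC mulVf // mul1r.
have DB : D *m b B = b B' *m D.
  rewrite /D mul_diag_mx mul_mx_diag; apply/matrixP => i j.
  by rewrite !mxE bB' mulfVK.
have DA : D *m b A = b A *m D.
  rewrite /D bA !mulmx_diag; congr diag_mx; apply/rowP => i.
  by rewrite !mxE mulrC.
(* [h] is [D] carried back to the standard basis. It preserves [J], and the scalar [c] then gives it
   determinant 1 without affecting conjugation. *)
have [h hP] : exists h : 'M[C]_3, h *m P = P *m D.
  by exists (P *m D *m invmx P); rewrite mulmxKV.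
have [|c _ suh] := @unitary_normalize h.
  apply: (can_inj (mulmxK Pu)); apply: (can_inj (mulKmx (_ : P^*t \in unitmx))).
    by rewrite map_unitmx unitmx_tr.
  rewrite !mulmxA -GE -ctmxM -mulmxA hP ctmxM.
  by rewrite -[in RHS]DG GE !mulmxA.
have intertwine M M' : D *m b M = b M' *m D -> (c *: h) *m M = M' *m (c *: h).
  move=> DM; rewrite -scalemxAl -scalemxAr; congr (_ *: _).
  apply: (can_inj (mulmxK Pu)); rewrite -!mulmxA (bE M) hP !mulmxA hP (bE M').
  by rewrite -!mulmxA DM.
by exists (c *: h); split=> //; apply: intertwine.
Qed.

End HermitianForm.

(** * Matrices with a repeated eigenvalue *)

(** If columns [i] and [j] of [P] share an eigenvalue, they span a plane of eigenvectors, namely the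
    kernel of the remaining row of [invmx P]. *)
Lemma repeated_eigenvalue_functional (K : fieldType) (A P : 'M[K]_3) (a : 'rV[K]_3) :
  P \in unitmx -> A *m P = P *m diag_mx a -> ~~ injectiveb (a 0) ->
  exists (s : K) (r : 'rV[K]_3),
    forall v : 'cV[K]_3, r *m v = 0 -> A *m v = s *: v.
Proof.
move=> Pu AP /injectivePn[i [j ij aij]]; have [k ijk] := uniq3_third ij.
exists (a 0 i), (row k (invmx P)) => v; rewrite -row_mul => /rowP/(_ 0).
rewrite -{2 3}[v](mulKVmx Pu); move: (invmx P *m v) => w; rewrite !mxE => wk.
rewrite mulmxA AP -mulmxA scalemxAr mul_diag_mx; congr (_ *m _).
by apply/colP; apply: (uniq3_ind ijk); rewrite !mxE -?aij // wk !mulr0.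
Qed.

(* Two planes in a 3-dimensional space share a line. *)
Lemma repeated_eigenvalues_common_eigenvector (K : fieldType)
    (A P B Q : 'M[K]_3) (a b : 'rV[K]_3) :
  P \in unitmx -> A *m P = P *m diag_mx a -> ~~ injectiveb (a 0) ->
  Q \in unitmx -> B *m Q = Q *m diag_mx b -> ~~ injectiveb (b 0) ->
  exists (v : 'cV[K]_3) s t, [/\ v != 0, A *m v = s *: v & B *m v = t *: v].
Proof.
move=> Pu AP ainj Qu BQ binj.
have [s [r sP]] := repeated_eigenvalue_functional Pu AP ainj.
have [t [q tP]] := repeated_eigenvalue_functional Qu BQ binj.
pose M : 'M_(3, 1 + 1) := row_mx r^T q^T.
(* [M] has three rows but rank at most 2, so some nonzero row is annihilated by both functionals. *)
have kerM : kermx M != 0.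
  by rewrite -mxrank_eq0 mxrank_ker subn_eq0 -ltnNge ltnS rank_leq_col.
pose u := nz_row (kermx M); exists u^T, s, t.
have : u *m M = 0 by apply/sub_kermxP/nz_row_sub.
rewrite /M mul_mx_row -[RHS]row_mx0 => /eq_row_mx[ur uq].
have tr0 (x : 'rV_3) : u *m x^T = 0 -> x *m u^T = 0.
  by move=> ux; apply: trmx_inj; rewrite trmx_mul trmxK ux trmx0.
split; first by rewrite trmx_eq0 nz_row_eq0.
- exact/sP/tr0.
- exact/tP/tr0.
Qed.

(** * Conjugacy of pairs in SU(2,1) *)

Section SpecialUnitary21.
Variable R : realType.
Local Notation C := R[i].

Definition form21 : 'M[C]_3 := diag_mx (\row_i if i == 2 then -1 else 1).

Lemma form21_conj : form21^*t = form21.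
Proof.
rewrite /form21 tr_diag_mx map_diag_mx; congr diag_mx; apply/rowP => i.
by rewrite !mxE; case: ifP => _; rewrite ?rmorphN rmorph1.
Qed.

Lemma form21_unit : form21 \in unitmx.
Proof.
rewrite unitmxE det_diag unitfE; apply/prodf_neq0 => i _.
by rewrite mxE; case: ifP; rewrite ?oppr_eq0 oner_eq0.
Qed.

Lemma herm21E (Z W : 'cV[C]_3) : herm21 Z W = (W^*t *m form21 *m Z) 0 0.
Proof.
rewrite mxE (@big_uniq3 _ _ 0 1 2) // /herm21 /form21 mul_mx_diag !mxE /=.
by rewrite !mulr1 mulrN1 mulNr ![_^* * _]mulrC.
Qed.

Lemma in_SU21P (A : 'M[C]_3) : in_SU21 A <-> special_unitary form21 A.
Proof.
split=> -[detA hA]; split=> //; last first.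
  by move=> Z W; rewrite !herm21E -[in RHS]hA ctmxM !mulmxA.
have entry (M : 'M[C]_3) i j :
    M i j = ((delta_mx i 0 : 'cV[C]_3)^*t *m M *m (delta_mx j 0 : 'cV[C]_3)) 0 0.
  have -> : (delta_mx i 0 : 'cV[C]_3)^*t = delta_mx 0 i.
    by apply/matrixP => k l; rewrite !mxE rmorph_nat andbC.
  by rewrite -colE -rowE !mxE.
apply/matrixP => i j; rewrite entry [RHS]entry -herm21E -hA herm21E.
by rewrite ctmxM !mulmxA.
Qed.

Lemma SU21_special_unitary (A : SU21 R) : special_unitary form21 A.
Proof. exact/in_SU21P/SU21_in. Qed.

Lemma SU21_mulE (A B : SU21 R) : (A * B)%g = (A : 'M_3) *m B :> 'M_3.
Proof. by []. Qed.

Lemma SU21_invE (A : SU21 R) : A^-1%g = invmx A :> 'M_3.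
Proof. by []. Qed.

Lemma SU21_expE (A : SU21 R) n : (A ^+ n)%g = (A : 'M_3) ^+ n :> 'M_3.
Proof. by elim: n => // n IHn; rewrite expgS exprS -IHn. Qed.

(** Through [form21], the inverse of [A] is similar to its conjugate transpose. *)
Lemma mxtr_inv (A : SU21 R) : mxtr A^-1%g = (mxtr A)^*.
Proof.
have [_ AJ] := SU21_special_unitary A.
have AVJ : form21 *m invmx A = (A : 'M_3)^*t *m form21.
  by rewrite -{1}AJ mulmxK // SU21_unit.
rewrite /mxtr /= -[invmx A](mulKmx form21_unit) AVJ mxtrace_mulC.
rewrite mulmxK ?form21_unit //.
by rewrite trace_map_mx mxtrace_tr.
Qed.

Lemma mxtr_conj (g A : SU21 R) : mxtr (g * A * g^-1)%g = mxtr A.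
Proof. by rewrite /mxtr /= mxtrace_mulC mulKmx ?SU21_unit. Qed.

Lemma conjugate_pair_regular (A B A' B' : SU21 R) (P : 'M[C]_3) (a : 'rV[C]_3) :
  P \in unitmx -> (A : 'M_3) *m P = P *m diag_mx a -> injective (a 0) ->
  (forall i, `|a 0 i| = 1) ->
  (forall (v : 'cV[C]_3) s t,
    (A : 'M_3) *m v = s *: v -> (B : 'M_3) *m v = t *: v -> v = 0) ->
  conjugate_in A A' -> mxtr B = mxtr B' ->
  mxtr (A * B)%g = mxtr (A' * B')%g ->
  mxtr (A^-1 * B)%g = mxtr (A'^-1 * B')%g ->
  'Im (mxtr (A * B * A^-1 * B^-1)%g) = 'Im (mxtr (A' * B' * A'^-1 * B'^-1)%g) ->
  exists g : SU21 R, A' = (g * A * g^-1)%g /\ B' = (g * B * g^-1)%g.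
Proof.
move=> Pu AP a_inj a1 noeig [k A'E] trB trAB trAVB trcom.
(* Pulling [B'] back by [k] reduces to two pairs with the same first matrix [A]. *)
have [B0 B'E] : exists B0, B' = (k * B0 * k^-1)%g.
  by exists (k^-1 * B' * k)%g; rewrite !mulgA mulgV mul1g mulgK.
have trB0 : mxtr B = mxtr B0 by rewrite trB B'E mxtr_conj.
have trAB0 : mxtr (A * B)%g = mxtr (A * B0)%g.
  by rewrite trAB A'E B'E -[RHS](mxtr_conj k) !mulgA mulgVK.
have trAVB0 : mxtr (A^-1 * B)%g = mxtr (A^-1 * B0)%g.
  by rewrite trAVB A'E B'E -[RHS](mxtr_conj k) !invgM invgK !mulgA mulgVK.
have trcom0 : 'Im (mxtr (A * B * A^-1 * B^-1)%g) =
    'Im (mxtr (A * B0 * A^-1 * B0^-1)%g).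
  rewrite trcom A'E B'E -(mxtr_conj k (A * B0 * A^-1 * B0^-1)%g).
  by rewrite !invgM !invgK !mulgA !mulgVK.
rewrite /mxtr !(SU21_mulE, SU21_invE) in trB0 trAB0 trAVB0 trcom0.
have [g [/in_SU21P/asboolP hg gA gB]] := special_unitary_pair_similar
    form21_unit form21_conj (SU21_special_unitary A) (SU21_special_unitary B)
    (SU21_special_unitary B0) Pu AP a_inj a1 noeig trB0 trAB0 trAVB0 trcom0.
have conj_of (X Y : SU21 R) : g *m X = (Y : 'M_3) *m g ->
    Y = (MkSU21 hg * X * (MkSU21 hg)^-1)%g.
  by move=> gX; apply: (mulIg (MkSU21 hg)); rewrite mulgVK; apply: val_inj.
exists (k * MkSU21 hg)%g; rewrite A'E B'E {1}(conj_of A A gA) {1}(conj_of B B0 gB).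
by rewrite invgM !mulgA.
Qed.

Lemma conjugate_pair (A B A' B' : SU21 R) m n :
  (0 < m)%N -> (A ^+ m)%g = 1%g -> (0 < n)%N -> (B ^+ n)%g = 1%g ->
  (forall (v : 'cV[C]_3) s t,
    (A : 'M_3) *m v = s *: v -> (B : 'M_3) *m v = t *: v -> v = 0) ->
  conjugate_in A A' -> conjugate_in B B' ->
  mxtr (A * B)%g = mxtr (A' * B')%g ->
  mxtr (A^-1 * B)%g = mxtr (A'^-1 * B')%g ->
  'Im (mxtr (A * B * A^-1 * B^-1)%g) = 'Im (mxtr (A' * B' * A'^-1 * B'^-1)%g) ->
  exists g : SU21 R, A' = (g * A * g^-1)%g /\ B' = (g * B * g^-1)%g.
Proof.
move=> m_gt0 Am n_gt0 Bn noeig conjA conjB trAB trAVB trcom.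
have diagonal (M : SU21 R) l : (0 < l)%N -> (M ^+ l)%g = 1%g ->
    exists (P : 'M[C]_3) (a : 'rV[C]_3),
    [/\ P \in unitmx, (M : 'M_3) *m P = P *m diag_mx a & forall i, `|a 0 i| = 1].
  move=> l_gt0 Ml; apply: (finite_order_diagonalizable l_gt0).
  by rewrite -SU21_expE Ml.
have trconj (M N : SU21 R) : conjugate_in M N -> mxtr M = mxtr N.
  by case=> g ->; rewrite mxtr_conj.
have [P [a [Pu AP a1]]] := diagonal A m m_gt0 Am.
have [Q [b [Qu BQ b1]]] := diagonal B n n_gt0 Bn.
have [a_inj|a_ninj] := boolP (injectiveb (a 0)).
  by apply: (conjugate_pair_regular Pu AP (injectiveP _ a_inj)) => //; exact: trconj.
have [b_inj|b_ninj] := boolP (injectiveb (b 0)); last first.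
  have [v [s [t [v0 Av Bv]]]] :=
    repeated_eigenvalues_common_eigenvector Pu AP a_ninj Qu BQ b_ninj.
  by rewrite (noeig v s t Av Bv) eqxx in v0.
(* The roles of [A] and [B] are exchanged. The trace of the product is unchanged, while B^-1 A and
   [B, A] are the inverses of A^-1 B and [A, B], so their traces are the conjugates. *)
have [|||||g [gB gA]] :=
    conjugate_pair_regular (B := A) (B' := A') Qu BQ (injectiveP _ b_inj) b1 _ conjB.
- by move=> v s t Bv Av; exact: noeig Av Bv.
- exact: trconj.
- by rewrite /mxtr /= mxtrace_mulC [RHS]mxtrace_mulC.
- by apply: (inv_inj conjCK); rewrite -!mxtr_inv !invgM !invgK.
- apply: oppr_inj; rewrite -!Im_conj -!mxtr_inv !invgM !invgK !mulgA.
  exact: trcom.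
by exists g; split; [exact: gA | exact: gB].
Qed.

End SpecialUnitary21.

(** * Homomorphisms and presented groups *)

Section MultiplicativeGroup.
Variables (G H : groupType) (f : {multiplicative G -> H}).

Lemma multiplicative1 : f 1%g = 1%g.
Proof. by apply: (mulgI (f 1%g)); rewrite -gmulfM !mulg1. Qed.

Lemma multiplicativeV u : f u^-1%g = (f u)^-1%g.
Proof. by apply/esym/mulg1_eq; rewrite -gmulfM mulgV multiplicative1. Qed.

Lemma multiplicativeX u n : f (u ^+ n)%g = (f u ^+ n)%g.
Proof.
by elim: n => [|n IHn]; rewrite ?multiplicative1 // !expgS gmulfM IHn.
Qed.

End MultiplicativeGroup.

Lemma presented_group_ind (X : Type) (rel : gterm X -> gterm X -> Prop)
    (Q : presented_group rel -> Prop) :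
  (forall g, Q (pres_gen rel g)) -> Q 1%g ->
  (forall u v, Q u -> Q v -> Q (u * v)%g) -> (forall u, Q u -> Q u^-1%g) ->
  forall u, Q u.
Proof.
move=> Qgen Q1 QM QV u; rewrite -(pres_reprK u).
elim: (pres_repr u) => [g||s Qs t Qt|s Qs]; first exact: Qgen.
- exact: Q1.
- by rewrite -pres_class_mul; apply: (QM _ _ Qs Qt).
- by rewrite -pres_class_inv; apply: (QV _ Qs).
Qed.

Lemma pres_class_expn (X : Type) (rel : gterm X -> gterm X -> Prop) s n :
  pres_class rel (gexpn s n) = (pres_class rel s ^+ n)%g.
Proof.
elim: n => // n IHn; rewrite expgS -IHn; exact/esym/pres_class_mul.
Qed.

(** * Irreducible representations of the Brieskorn group *)

Section BrieskornRep.
Variables (R : realType) (p q r : nat) (a b c : int).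
Local Notation C := R[i].
Local Notation G := (brieskorn_pi1 p q r a b c).
Local Notation gen := (pres_gen (brieskorn_rel p q r a b c)).
Variable rho : {multiplicative G -> SU21 R}.
Hypothesis irr : irreducible_rep rho.

Lemma brieskorn_h_central (u : G) : (gen gen_h * u)%g = (u * gen gen_h)%g.
Proof.
elim/presented_group_ind: u => [g||u v hu hv|u hu].
- apply: etrans (pres_class_mul _ _ _) (etrans _ (esym (pres_class_mul _ _ _))).
  exact/pres_classP/pres_rel/rel_central.
- by rewrite mulg1 mul1g.
- by rewrite mulgA hu -mulgA hv mulgA.
- by apply: (mulgI u); rewrite mulgA -hu mulgK mulgA mulgV mul1g.
Qed.

Lemma brieskorn_zE : gen gen_z = ((gen gen_x * gen gen_y)^-1)%g.
Proof.
have xyz : (gen gen_x * gen gen_y * gen gen_z)%g = 1%g.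
  rewrite [X in (X * _)%g](pres_class_mul _ (GGen gen_x) (GGen gen_y)).
  apply: etrans (pres_class_mul _ _ _) _.
  exact/pres_classP/pres_rel/rel_xyz.
exact/esym/mulg1_eq/xyz.
Qed.

(** Schur's lemma: an eigenspace of [rho h] is invariant because [h] is central, hence it is the
    whole space. *)
Lemma brieskorn_h_scalar : exists s : C, (rho (gen gen_h) : 'M_3) = s%:M.
Proof.
set H := (rho (gen gen_h) : 'M_3).
(* The transpose appears because [eigenvalue] concerns row vectors. *)
have [s] : exists s, root (char_poly H^T) s.
  by apply: closed_rootP; rewrite size_char_poly.
rewrite -eigenvalue_root_char => /eigenvalueP[u uH u0].
pose f : 'Hom('cV[C]_3, 'cV[C]_3) := linfun (mulmx (H - s%:M)).
have kerf v : (v \in lker f) = (H *m v == s *: v).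
  by rewrite memv_ker lfunE /= mulmxBl subr_eq0 mul_scalar_mx.
exists s; have [|ker0|kerT] := @irr (lker f).
- move=> g v; rewrite !kerf => /eqP Hv; rewrite mulmxA.
  have -> : H *m rho g = (rho g : 'M_3) *m H.
    by rewrite -!SU21_mulE -!gmulfM brieskorn_h_central.
  by rewrite -mulmxA Hv scalemxAr.
- have : u^T \in lker f by rewrite kerf -[H]trmxK -trmx_mul uH linearZ.
  by rewrite ker0 memv0 trmx_eq0 (negPf u0).
- apply/matrixP => i j.
  have : delta_mx j 0 \in lker f by rewrite kerT memvf.
  by rewrite kerf -mul_scalar_mx -!colE => /eqP/colP/(_ i); rewrite !mxE.
Qed.

(** A nonzero common eigenvector would span an invariant line: [z] is the inverse of [x * y] and [h]
    acts by a scalar, so every element preserves that line. *)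
Lemma brieskorn_common_eigenvector (v : 'cV[C]_3) s t :
  (rho (gen gen_x) : 'M_3) *m v = s *: v ->
  (rho (gen gen_y) : 'M_3) *m v = t *: v -> v = 0.
Proof.
move=> xv yv.
have scal u : exists s, (rho u : 'M_3) *m v = s *: v.
  have mul w1 w2 : (exists s, (rho w1 : 'M_3) *m v = s *: v) ->
      (exists s, (rho w2 : 'M_3) *m v = s *: v) ->
      exists s, (rho (w1 * w2)%g : 'M_3) *m v = s *: v.
    move=> [s1 w1v] [s2 w2v]; exists (s2 * s1).
    by rewrite gmulfM SU21_mulE -mulmxA w2v -scalemxAr w1v scalerA.
  have inv w : (exists s, (rho w : 'M_3) *m v = s *: v) ->
      exists s, (rho w^-1%g : 'M_3) *m v = s *: v.
    move=> [s1 wv]; exists s1^-1; rewrite multiplicativeV SU21_invE.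
    have [s10|s10] := eqVneq s1 0.
      have v0 : v = 0 by rewrite -(mulKmx (SU21_unit (rho w)) v) wv s10 scale0r mulmx0.
      by rewrite v0 mulmx0 scaler0.
    apply: (can_inj (mulKmx (SU21_unit (rho w)))).
    by rewrite mulKVmx ?SU21_unit // -scalemxAr wv scalerA mulVf // scale1r.
  elim/presented_group_ind: u => [[]||u1 u2|u1].
  - by exists s.
  - by exists t.
  - by rewrite brieskorn_zE; apply: inv; apply: mul; [exists s | exists t].
  - have [l ->] := brieskorn_h_scalar.
    by exists l; rewrite mul_scalar_mx.
  - by exists 1; rewrite multiplicative1 scale1r mul1mx.
  - exact: mul.
  - exact: inv.
have [u w|v0|vT] := @irr <[v]>%VS.
- by move/vlineP => [l ->]; have [m um] := scal u; rewrite -scalemxAr um !memvZ // memv_line.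
- by apply/eqP; rewrite -memv0 -v0 memv_line.
- have := dimvf 'cV[C]_3; rewrite -vT dim_vline dim_matrix.
  by case: (v != 0).
Qed.

Lemma brieskorn_h_cube : (rho (gen gen_h) ^+ 3)%g = 1%g.
Proof.
have [s hs] := brieskorn_h_scalar; apply: val_inj.
apply: (etrans (SU21_expE _ _)); rewrite hs.
have [] := SU21_special_unitary (rho (gen gen_h)).
by rewrite hs det_scalar => s3 _; rewrite -rmorphXn s3.
Qed.

(** The relation makes the [d]-th power of the generator a power of [h], and the image of [h] has
    trivial cube. *)
Lemma brieskorn_finite_order g d (e : int) :
  brieskorn_rel p q r a b c
    (GMul (gexpn (GGen g) d) (gexpz (GGen gen_h) e)) GOne ->
  (rho (gen g) ^+ (d * 3))%g = 1%g.
Proof.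
move=> rel_gh.
have hn n : (rho (gen gen_h ^+ n)%g ^+ 3)%g = 1%g.
  by rewrite multiplicativeX -expgnA mulnC expgnA brieskorn_h_cube expg1n.
have he : (rho (pres_class _ (gexpz (GGen gen_h) e)) ^+ 3)%g = 1%g.
  case: e {rel_gh} => n /=; first by rewrite pres_class_expn hn.
  rewrite -pres_class_inv (pres_class_expn _ (GGen gen_h) n.+1).
  by rewrite multiplicativeV expVgn hn invg1.
have ghe : (gen g ^+ d)%g = (pres_class _ (gexpz (GGen gen_h) e))^-1%g.
  apply: (mulIg (pres_class _ (gexpz (GGen gen_h) e))).
  rewrite mulVg -pres_class_expn.
  apply: etrans (pres_class_mul _ _ _) _.
  exact/pres_classP/pres_rel/rel_gh.
by rewrite expgnA -multiplicativeX ghe multiplicativeV expVgn he invg1.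
Qed.

End BrieskornRep.

Local Open Scope ring_scope.

Theorem theorem3p1 (R : realType) (p q r : nat)
  (p_gt0 : (0 < p)%N) (q_gt0 : (0 < q)%N) (r_gt0 : (0 < r)%N)
  (cop_pq : coprime p q) (cop_pr : coprime p r) (cop_qr : coprime q r)
  (a b c : int)
  (abc : a%:~R / p%:R + b%:~R / q%:R + c%:~R / r%:R
         = 1 / (p * q * r)%N%:R :> rat)
  (rho rho' : {multiplicative brieskorn_pi1 p q r a b c -> SU21 R})
  (irr_rho : irreducible_rep rho) (irr_rho' : irreducible_rep rho') :
  let x := pi1_x p q r a b c in
  let y := pi1_y p q r a b c in
  let h := pi1_h p q r a b c in
  conjugate_rep rho rho' <->
  [/\ conjugate_in (rho x) (rho' x),
      conjugate_in (rho y) (rho' y)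
    & conjugate_in (rho h) (rho' h)] /\
  [/\ mxtr (rho (x * y)%g) = mxtr (rho' (x * y)%g),
      mxtr (rho (x^-1 * y)%g) = mxtr (rho' (x^-1 * y)%g)
    & 'Im (mxtr (rho (x * y * x^-1 * y^-1)%g)) =
      'Im (mxtr (rho' (x * y * x^-1 * y^-1)%g))].

Proof.
move=> x y h; split=> [[g rhoE]|[[conj_x conj_y [k rho'h]] [trxy trxVy trcom]]].
  have trE w : mxtr (rho w) = mxtr (rho' w) by rewrite rhoE mxtr_conj.
  by split; split; rewrite ?trE //; exists g; exact: rhoE.
rewrite !gmulfM !multiplicativeV in trxy trxVy trcom.
have p3_gt0 : (0 < p * 3)%N by rewrite muln_gt0 p_gt0.
have q3_gt0 : (0 < q * 3)%N by rewrite muln_gt0 q_gt0.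
have [g [gx gy]] := conjugate_pair
  p3_gt0 (brieskorn_finite_order irr_rho (rel_x p q r a b c))
  q3_gt0 (brieskorn_finite_order irr_rho (rel_y p q r a b c))
  (brieskorn_common_eigenvector irr_rho) conj_x conj_y trxy trxVy trcom.
(* As [rho h] is scalar, its conjugacy class is a single element. Hence [rho' h = rho h], and the
   [g] found for [x] and [y] also serves for [h]. *)
have hC (m : SU21 R) : (m * rho h * m^-1)%g = rho h.
  have [s hs] := brieskorn_h_scalar irr_rho.
  apply: (mulIg m); rewrite mulgVK; apply: val_inj.
  by rewrite /= hs scalar_mxC.
exists g; elim/presented_group_ind => [[]||u v gu gv|u gu].
- exact: gx.
- exact: gy.
- rewrite brieskorn_zE !multiplicativeV !gmulfM gx gy.
  by rewrite !invgM !invgK !mulgA !mulgVK.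
- by rewrite [LHS]rho'h [LHS]hC [RHS]hC.
- by rewrite !multiplicative1 mulg1 mulgV.
- by rewrite !gmulfM gu gv !mulgA mulgVK.
- by rewrite !multiplicativeV gu !invgM invgK !mulgA.
Qed.
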